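(* For every $z\in\mathbb{C}$ with $\operatorname{Re} z>0$ we have an asymptotic expansion as $n\to\infty$ $$\mathcal{F}_n(\mathcal{Q},z)=\sum_{k=0}^\infty A_k(z)\,n^{-k}.$$ Here the term $A_k(z)$ is a holomorphic function on $\mathbb{C}$ whose coefficients are universal elements in the ring of polynomials $\mathbb{C}(d)[\mu_1,\mu_2,\dots,\mu_k]$, where $\mathbb{C}(d)$ denotes the field of rational functions in the variable $d=\deg\mathcal{Q}$.
   Context: Let $\mathcal{Q}(t)=\prod_{i=1}^d(t+r_i)$ be a complex polynomial of degree $d$ with leading coefficient $1$, and let $\vec r=(r_1,\dots,r_d)\in\mathbb{C}^d$. For a positive integer $n$ and $z\in\mathbb{C}$ with $\operatorname{Re}z>0$, set $$\mathcal{F}_n(\mathcal{Q},z)=\frac{z^{dn+1}}{(dn)!}\int_0^\infty e^{-zt}\,\mathcal{Q}(t)^n\,dt .$$ Set $\mu_s=\mu_s(\vec r)=\frac1d\sum_{i=1}^d r_i^s$. The ''coefficients'' of $A_k(z)$ are its power series coefficients in $z$. The equality is meant as an asymptotic expansion: for every $\ell\ge 0$, $\mathcal{F}_n(\mathcal{Q},z)-\sum_{k=0}^{\ell}A_k(z)n^{-k}=O(n^{-\ell-1})$ as $n\to\infty$.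
   Formalization: The coefficients of A_k(z) are shown to lie in C(d)[mu_1,...,mu_{k+1}] instead of C(d)[mu_1,...,mu_k], which is false as stated: A_0(z)=exp(mu_1 z), and for Q=t^2-a^2 one has mu_1=0 but A_1(z)=-a^2 z^2/4. *)

(* Defs.v *)
From HB Require Import structures.
From mathcomp Require Import all_boot all_order all_algebra.
From mathcomp Require Import complex.
(* Not imported: the notations of mpoly clash with those of the analysis
   library, so its constants are used with qualified names. *)
From mathcomp Require mpoly.
From mathcomp Require Import all_classical all_reals all_analysis.

Set Implicit Arguments.
Unset Strict Implicit.
Unset Printing Implicit Defensive.

Import Order.TTheory GRing.Theory Num.Theory.
Import numFieldNormedType.Exports.

Local Open Scope classical_set_scope.
Local Open Scope ring_scope.
Local Open Scope complex_scope.

Definition cexp (R : realType) (z : R[i]) : R[i] :=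
  (expR (complex.Re z) * cos (complex.Im z)) +i*
  (expR (complex.Re z) * sin (complex.Im z)).

Definition cintegral0y (R : realType) (f : R -> R[i]) : R[i] :=
  (\int[lebesgue_measure]_(t in `[0, +oo[) complex.Re (f t)) +i*
  (\int[lebesgue_measure]_(t in `[0, +oo[) complex.Im (f t)).

Definition Fn (R : realType) (Q : {poly R[i]}) (n : nat) (z : R[i]) : R[i] :=
  let d := (size Q).-1 in
  z ^+ (d * n).+1 / ((d * n)`!)%:R *
  cintegral0y (fun t : R => cexp (- z * t%:C) * Q.[t%:C] ^+ n).

Definition mu (R : realType) (d : nat) (r : 'I_d -> R[i]) (s : nat) : R[i] :=
  d%:R^-1 * \sum_(i < d) r i ^+ s.

(* The regular algebra R[i]^o carries the normed topology of R[i]. *)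
Definition entire (R : realType) (f : R[i] -> R[i]) : Prop :=
  forall z : R[i], derivable (f : R[i]^o -> R[i]^o) z 1.

Definition has_coefs (R : realType) (f : R[i] -> R[i]) (a : nat -> R[i]) :
    Prop :=
  forall z : R[i],
    series (fun j : nat => a j * z ^+ j : R[i]^o) @ \oo --> (f z : R[i]^o).

(* C(d), with 'X of {poly R[i]} in the role of the indeterminate d. *)
Definition Cd (R : realType) := {fraction {poly R[i]}}.

(* C(d)[mu_1, ..., mu_m]; the variable of index i : 'I_m stands for
   mu_(i + 1).  The n^-k term A_k of the expansion of Fn needs m = k + 1 and
   not m = k: A_0(z) = exp(mu_1 z), and for Q = (t - a)(t + a), where mu_1 = 0
   and mu_2 = a^2, A_1(z) = - a^2 z^2 / 4. *)
Definition Cdmu (R : realType) (m : nat) := mpoly.mpoly m (Cd R).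

(* The rational function f has no pole at x, and takes the value v there. *)
Definition Cd_value (R : realType) (f : Cd R) (x v : R[i]) : Prop :=
  exists p q : {poly R[i]},
    [/\ q.[x] != 0, f = FracField.tofrac p / FracField.tofrac q
      & v = p.[x] / q.[x]].

(* No coefficient of P has a pole at the integer d, and v is the value of P
   at d and mu_1 = mu r 1, ..., mu_m = mu r m. *)
Definition Cdmu_value (R : realType) (m : nat) (P : Cdmu R m)
    (d : nat) (r : 'I_d -> R[i]) (v : R[i]) : Prop :=
  exists S : mpoly.mpoly m R[i],
    (forall e : mpoly.multinom m,
       Cd_value (mpoly.mcoeff e P) d%:R (mpoly.mcoeff e S)) /\
    v = mpoly.meval (fun i : 'I_m => mu r i.+1) S.

(* Main.v *)
(* Write N = d n and x = 1/N.  Integrating term by term,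
     Fn Q n z = \sum_(m <= N) u_m z^m,   u_m = e_m / (N (N-1) ... (N-m+1)),
   where e_m is the coefficient of s^m in \prod_i (1 + r_i s)^n.  Newton's
   identities make e_m / N^m a polynomial in x whose x^p coefficient only
   involves mu_1, ..., mu_(p+1), while the remaining factor
   \prod_(i < m) 1 / (1 - i x) expands with complete homogeneous symmetric
   functions of 0, ..., m - 1.  The coefficient of x^k in u_m, times d^-k, is
   the coefficient of z^m in A_k.
   If every |r_i| <= M then |u_m| <= M^m / m!, and as long as 2 m^2 x <= 1 the
   remainder of order L of u_m is at most 4 (M^m / m!) (2 m^2 x)^L.  For
   2 m^2 x > 1 the trivial bounds give an estimate of the same shape, so the
   remainders can be summed over m. *)
Require Import Defs.
From HB Require Import structures.
From mathcomp Require Import all_boot all_order all_algebra.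
From mathcomp Require Import complex.
From mathcomp Require Import -(notations) mpoly.
From mathcomp Require Import all_classical all_reals all_analysis.
From mathcomp Require Import measurable_realfun.
From mathcomp Require Import zify ring.

Set Implicit Arguments.
Unset Strict Implicit.
Unset Printing Implicit Defensive.

Import Order.TTheory GRing.Theory Num.Theory.
Import numFieldNormedType.Exports.

Local Open Scope classical_set_scope.
Local Open Scope ring_scope.
Local Open Scope complex_scope.

(** * Coefficients *)

(* The coefficient of N^j s^m in exp (N \sum_i (-1)^i mu_(i+1) s^(i+1) / (i+1)),
   computed by Newton's identities; [mu i] stands for mu_(i+1), and [w m] for
   1/m, which lets the definition make sense over polynomial rings. *)
Fixpoint expN_coef (A : comPzRingType) (w mu : nat -> A) (j m : nat) : A :=
  if j is j'.+1 then
    w m * \sum_(i < m) (-1) ^+ i * mu i * expN_coef w mu j' (m.-1 - i)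
  else (m == 0%N)%:R.

(* The complete homogeneous symmetric function of degree q in 0, ..., m - 1. *)
Fixpoint hsym_iota (m q : nat) : nat :=
  if m is m'.+1 then \sum_(i < q.+1) hsym_iota m' i * m' ^ (q - i)
  else (q == 0).

(* The coefficient of x^k in u_m.  Without the test on p, truncated subtraction
   would make m = 0 contribute to every k. *)
Definition ratio_coef (A : comPzRingType) (w mu : nat -> A) (k m : nat) : A :=
  \sum_(p < k.+1)
    (if (p <= m)%N then expN_coef w mu (m - p) m else 0)
      * (hsym_iota m (k - p))%:R.

Lemma rmorph_expN_coef (A B : comPzRingType) (f : {rmorphism A -> B})
    (w mu : nat -> A) j m :
  f (expN_coef w mu j m) = expN_coef (f \o w) (f \o mu) j m.
Proof.
elim: j m => [|j IH] m /=; first by rewrite rmorph_nat.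
rewrite rmorphM rmorph_sum; congr (_ * _); apply: eq_bigr => i _.
by rewrite !rmorphM rmorphXn rmorphN1 IH.
Qed.

Lemma rmorph_ratio_coef (A B : comPzRingType) (f : {rmorphism A -> B})
    (w mu : nat -> A) k m :
  f (ratio_coef w mu k m) = ratio_coef (f \o w) (f \o mu) k m.
Proof.
rewrite rmorph_sum; apply: eq_bigr => p _.
rewrite rmorphM rmorph_nat; congr (_ * _).
by case: ifP => _; rewrite ?rmorph0// rmorph_expN_coef.
Qed.

(** Each factor N carries at least one power of s. *)
Lemma expN_coef_gt (A : comPzRingType) (w mu : nat -> A) j m :
  (m < j)%N -> expN_coef w mu j m = 0.
Proof.
elim: j m => [//|j IH] m /= mj.
rewrite big1 ?mulr0// => i _; rewrite IH ?mulr0//.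
by have := ltn_ord i; lia.
Qed.

(** Picking the index [i] uses up i + 1 powers of s, and each of the other j - 1 factors needs at
    least one more; hence i <= m - j < K. *)
Lemma eq_expN_coef (A : comPzRingType) (w mu mu' : nat -> A) K j m :
  (forall i, (i < K)%N -> mu i = mu' i) -> (m < j + K)%N ->
  expN_coef w mu j m = expN_coef w mu' j m.
Proof.
move=> eq_mu; elim: j m => [//|j IH] m /= mj.
congr (_ * _); apply: eq_bigr => i _.
have im := ltn_ord i; case: (ltnP i K) => iK.
  by rewrite eq_mu// IH//; lia.
by rewrite !expN_coef_gt ?mulr0//; lia.
Qed.

(** Here j = m - p with p <= k, so only indices up to k are reached; this is what limits A_k to
    mu_1, ..., mu_(k+1). *)
Lemma eq_ratio_coef (A : comPzRingType) (w mu mu' : nat -> A) k m :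
  (forall i, (i <= k)%N -> mu i = mu' i) ->
  ratio_coef w mu k m = ratio_coef w mu' k m.
Proof.
move=> eq_mu; apply: eq_bigr => p _; congr (_ * _).
case: ifP => // pm; apply: (eq_expN_coef _ (K := k.+1)) => //.
by have := ltn_ord p; lia.
Qed.

(** * Newton's identities and products of linear factors *)

Section Newton.
Variable F : numFieldType.
Implicit Types (r : F) (rs : seq F).

(* Newton's identities in the form [s G' = P G] modulo [s^D.+1]; in this form
   they are stable under products. *)
Lemma newton_poly rs D :
  dvdp 'X^(D.+1)
    ('X * (\prod_(r <- rs) (1 + r *: 'X : {poly F}))^`()
     - (\sum_(i < D) ((-1) ^+ i * \sum_(r <- rs) r ^+ i.+1) *: 'X^(i.+1))
       * \prod_(r <- rs) (1 + r *: 'X)).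
Proof.
elim: rs => [|r rs IH].
  rewrite big_nil derivC mulr0 big1 ?mul0r ?subr0 ?dvdp0// => i _.
  by rewrite big_nil mulr0 scale0r.
(* The new factor contributes its logarithmic derivative, r X / (1 + r X) after multiplication by X;
   its truncated geometric series times 1 + r X telescopes. *)
have geom : \sum_(i < D) ((-1) ^+ i * r ^+ i.+1) *: 'X^(i.+1) * (1 + r *: 'X)
    = r *: 'X + ((-1) ^+ D.+1 * r ^+ D.+1) *: 'X^(D.+1) :> {poly F}.
  elim: D {IH} => [|D IH].
    by rewrite big_ord0 !expr1 mulN1r scaleNr subrr.
  rewrite big_ord_recr /= IH -!mul_polyC !polyCM !polyC_exp !polyCN !polyC1.
  rewrite !exprS; move: ((-1) ^+ D) (r%:P ^+ D) ('X^D) => a b c.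
  ring.
rewrite !big_cons.
set G := \prod_(r <- rs) _ in IH *.
set P := \sum_(i < D) _ in IH *.
under eq_bigr => i _ do rewrite big_cons mulrDr scalerDl.
rewrite big_split /= -/P derivM derivD derivC derivZ derivX add0r alg_polyC.
set g := \sum_(i < D) _.
have -> : 'X * (r%:P * G + (1 + r *: 'X) * G^`())
     - (g + P) * ((1 + r *: 'X) * G)
   = (r *: 'X - g * (1 + r *: 'X)) * G + (1 + r *: 'X) * ('X * G^`() - P * G).
  by rewrite -!mul_polyC; ring.
rewrite dvdp_add//; last by rewrite dvdp_mull.
rewrite mulr_suml geom opprD addrA subrr add0r -scaleNr -scalerAl.
by rewrite -mul_polyC dvdp_mull// dvdp_mulr// dvdpp.
Qed.


Lemma size_prod_1DZX rs :
  (size (\prod_(r <- rs) (1 + r *: 'X : {poly F}))%R <= (size rs).+1)%N.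
Proof.
elim: rs => [|r rs IH]; first by rewrite big_nil size_poly1.
rewrite big_cons (leq_trans (size_polyMleq _ _))//=.
have r2 : (size (1 + r *: 'X : {poly F})%R <= 2)%N.
  rewrite (leq_trans (size_polyD _ _))// geq_max size_poly1/=.
  by rewrite (leq_trans (size_scale_leq _ _))// size_polyX.
by rewrite -subn1 leq_subLR (leq_trans (leq_add r2 IH)).
Qed.

Lemma coef_1DZXM r (p : {poly F}) m :
  ((1 + r *: 'X) * p)`_m = p`_m + (if m == 0 then 0 else r * p`_m.-1).
Proof.
rewrite mulrDl mul1r -scalerAl coefD coefZ coefXM.
by case: m => [|m] //=; rewrite mulr0.
Qed.

Lemma coef0_prod_1DZX rs : (\prod_(r <- rs) (1 + r *: 'X : {poly F}))`_0 = 1.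
Proof.
elim: rs => [|r rs IH]; first by rewrite big_nil coef1.
by rewrite big_cons coef_1DZXM IH addr0.
Qed.

Lemma newton_coef rs m :
  (\prod_(r <- rs) (1 + r *: 'X : {poly F}))`_m *+ m
  = \sum_(i < m) (-1) ^+ i * (\sum_(r <- rs) r ^+ i.+1)
      * (\prod_(r <- rs) (1 + r *: 'X : {poly F}))`_(m.-1 - i).
Proof.
(* Truncating at D = m loses nothing: a multiple of X^(m+1) has no coefficient of degree m. *)
have /dvdpP[q] := newton_poly rs m.
set G := \prod_(r <- rs) _ => /(congr1 (coefp m)) /=.
rewrite coefMXn leqnn coefB coefXM coef_deriv => /eqP.
rewrite subr_eq0 => /eqP GE.
case: m GE => [|m] GE; first by rewrite mulr0n big_ord0.
rewrite [LHS]GE mulr_suml coef_sum; apply: eq_bigr => i _.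
rewrite -scalerAl coefZ coefXnM.
by rewrite ltnNge ltn_ord.
Qed.

(** With power sums N mu_(i+1), Newton's identities become the recursion that defines [expN_coef],
    each step contributing one factor N. *)
Lemma coef_prod_1DZX (mu : nat -> F) (N : F) rs m :
  (forall i, \sum_(r <- rs) r ^+ i.+1 = N * mu i) ->
  (\prod_(r <- rs) (1 + r *: 'X : {poly F}))`_m
  = \sum_(j < m.+1) N ^+ j * expN_coef (fun m => m%:R^-1) mu j m.
Proof.
move=> pE; elim/ltn_ind: m => -[_|m IH].
  by rewrite coef0_prod_1DZX big_ord1 mul1r.
apply: (mulfI (_ : m.+1%:R != 0)); first by rewrite pnatr_eq0.
rewrite mulr_natl newton_coef [X in _ * X]big_ord_recl /= mulr0 add0r mulr_sumr.
under [RHS]eq_bigr => j _.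
  rewrite exprS /= mulrCA -!mulrA mulVKf ?pnatr_eq0// !mulr_sumr.
  over.
rewrite /= [RHS]exchange_big; apply: eq_bigr => i _.
have im : (m - i < m.+1)%N by rewrite ltnS leq_subr.
rewrite pE /= IH//.
(* Extending the inner sum to m + 1 terms only adds terms with j > m - i, which vanish. *)
rewrite (big_ord_widen _
  (fun j => N ^+ j * expN_coef (fun m => m%:R^-1) mu j (m - i)) im).
rewrite big_mkcond mulr_sumr; apply: eq_bigr => j _ /=.
case: ifPn; first by move=> _; ring.
by rewrite -leqNgt => ij; rewrite expN_coef_gt// !mulr0.
Qed.

Lemma size_prod_XD rs : size (\prod_(r <- rs) ('X + r%:P)) = (size rs).+1.
Proof.
rewrite -(size_prod_XsubC rs -%R); congr (size (polyseq _)).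
by apply: eq_bigr => s _; rewrite polyCN opprK.
Qed.

(** Reversing the order of the coefficients turns each factor X + r into 1 + r X. *)
Lemma coef_prod_XD rs m : (m <= size rs)%N ->
  (\prod_(r <- rs) ('X + r%:P))`_(size rs - m)
  = (\prod_(r <- rs) (1 + r *: 'X : {poly F}))`_m.
Proof.
elim: rs m => [[]// _|r rs IH m]; first by rewrite !big_nil coef1.
rewrite !big_cons coef_1DZXM mulrDl coefD coefXM coefCM /= => mrs.
case: m mrs => [_|m mrs].
  rewrite subn0 /= addr0 -[X in _`_X]subn0 IH//.
  by rewrite [X in r * X]nth_default ?mulr0 ?addr0 ?size_prod_XD.
rewrite subSS /= IH//; congr (_ + _).
case: ifP; rewrite subn_eq0 => rsm.
  by rewrite nth_default// (leq_trans (size_prod_1DZX _)).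
rewrite -IH; last by rewrite ltnNge rsm.
by congr (_`_ _); lia.
Qed.

(** The coefficient is a sum of binomially many products of m entries of [rs]; the induction is
    Pascal's rule. *)
Lemma norm_coef_prod_1DZX (M : F) rs m : 0 <= M ->
  {in rs, forall r, `|r| <= M} ->
  `|(\prod_(r <- rs) (1 + r *: 'X : {poly F}))`_m| <= M ^+ m *+ 'C(size rs, m).
Proof.
move=> M0; elim: rs m => [|r rs IH] m rsM.
  rewrite big_nil coef1; case: m => [|m]/=; first by rewrite normr1.
  by rewrite normr0 mulr0n.
have {}IH k : `|(\prod_(r <- rs) (1 + r *: 'X : {poly F}))`_k|
    <= M ^+ k *+ 'C(size rs, k).
  by apply: IH => s srs; rewrite rsM// in_cons srs orbT.
rewrite big_cons coef_1DZXM; case: m => [|m] /=.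
  by rewrite addr0 (le_trans (IH 0)) ?bin0.
rewrite binS mulrnDr (le_trans (ler_normD _ _))// lerD// normrM exprS -mulrnAr.
by rewrite ler_pM// rsM// in_cons eqxx.
Qed.

End Newton.

(** * Quantitative expansions *)

Section Estimates.
Variable F : numFieldType.
Implicit Types (x v K S M : F) (a mu : nat -> F) (rs : seq F).

Lemma ffact_le_expn n m : (n ^_ m <= n ^ m)%N.
Proof. by elim: m => // m IH; rewrite ffactnSr expnSr leq_mul// leq_subr. Qed.

Lemma sum_expr_le (a b : F) p : 0 <= a -> 0 <= b ->
  \sum_(i < p.+1) a ^+ i * b ^+ (p - i) <= (a + b) ^+ p.
Proof.
move=> a0 b0; rewrite addrC exprDn; apply: ler_sum => i _.
rewrite [X in X <= _]mulrC -mulr_natr ler_peMr ?mulr_ge0 ?exprn_ge0// ler1n.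
by rewrite bin_gt0 -ltnS.
Qed.

(** For j = m the coefficient is mu_1^m / m!. Each missing factor N costs at most m^2, a crude bound
    that survives the recursion because m + m^2 <= (m + 1)^2. *)
Lemma norm_expN_coef M mu j m :
  (forall i, `|mu i| <= M ^+ i.+1) -> (j <= m)%N ->
  `|expN_coef (fun m => m%:R^-1) mu j m|
    <= M ^+ m / m`!%:R * (m ^ 2)%:R ^+ (m - j).
Proof.
move=> muM; have M0 : 0 <= M by rewrite (le_trans _ (muM 0)) ?normr_ge0.
elim: j m => [|j IH] [|m] //= jm.
- by rewrite normr1 !expr0 fact0 invr1 !mul1r.
- by rewrite normr0 mulr_ge0// ?exprn_ge0 ?divr_ge0 ?exprn_ge0 ?ler0n.
rewrite subSS; move: jm; rewrite ltnS => jm.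
rewrite normrM ger0_norm ?invr_ge0 ?ler0n// factS natrM invfM mulrCA -mulrA.
rewrite ler_pM2l ?invr_gt0 ?ltr0n//.
rewrite (le_trans (ler_norm_sum _ _ _))//.
pose p := (m - j)%N.
have mE : (m.+1 = p.+1 + j)%N by rewrite /p; lia.
rewrite mE.
rewrite big_split_ord /= [X in _ + X]big1 ?addr0; last first.
  move=> i _; rewrite expN_coef_gt ?mulr0 ?normr0//= /p; have := ltn_ord i; lia.
rewrite -mE.
apply: (@le_trans _ _ (\sum_(i < p.+1)
    M ^+ m.+1 / m`!%:R * (m%:R ^+ i * (m ^ 2)%:R ^+ (p - i)))).
  apply: ler_sum => i _; rewrite !normrM normrX normrN1 expr1n mul1r.
  have ip : (i <= m - j)%N by rewrite -ltnS.
  apply: le_trans (ler_pM _ _ (muM _) (IH _ _)) _ => //; first by lia.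
  have -> : M ^+ m.+1 = M ^+ i.+1 * M ^+ (m - i).
    by rewrite -exprD; congr (_ ^+ _); lia.
  rewrite -!mulrA ler_wpM2l ?exprn_ge0// ler_wpM2l ?exprn_ge0//.
  (* The quotient m! / (m - i)! is a falling factorial, at most m^i. *)
  rewrite mulrA; apply: ler_pM; rewrite ?invr_ge0 ?ler0n ?exprn_ge0 ?ler0n//.
    rewrite mulrC ler_pdivlMr ?ltr0n ?fact_gt0// mulrC.
    rewrite ler_pdivrMr ?ltr0n ?fact_gt0// -natrX -natrM ler_nat.
    rewrite -(@ffact_fact m i) ?leq_mul2r; last by lia.
    by rewrite ffact_le_expn orbT.
  have -> : (m - i - j = p - i)%N by rewrite /p; lia.
  by rewrite lerXn2r ?nnegrE ?ler0n// ler_nat leq_exp2r// leq_subr.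
rewrite -mulr_sumr ler_wpM2l ?divr_ge0 ?exprn_ge0 ?ler0n//.
rewrite (le_trans (sum_expr_le _ _ _)) ?ler0n//.
rewrite lerXn2r ?nnegrE ?addr_ge0 ?ler0n// -natrD ler_nat; lia.
Qed.

(* [v = a 0 + a 1 x + a 2 x^2 + ...] with geometric control of the
   coefficients and of all the remainders; the constants are chosen so that
   products of expansions need no further loss. *)
Definition expansion v x a K S : Prop :=
  (forall k, `|a k| <= K * S ^+ k) /\
  (forall L, `|v - \sum_(k < L) a k * x ^+ k| <= K * (S * x) ^+ L).

Lemma expansion_ge0 v x a K S : expansion v x a K S -> 0 <= K.
Proof.
by case=> /(_ 0%N) + _; rewrite expr0 mulr1; apply: le_trans; rewrite normr_ge0.
Qed.

Lemma expansion_le v x a K S K' S' : 0 <= x -> 0 <= S -> K <= K' -> S <= S' ->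
  expansion v x a K S -> expansion v x a K' S'.
Proof.
move=> x0 S0 KK' SS' vx; have K0 := expansion_ge0 vx.
have S'0 := le_trans S0 SS'; case: vx => aK vK.
split=> [k|L].
  apply: le_trans (aK k) _; apply: ler_pM; rewrite ?exprn_ge0//.
  by rewrite lerXn2r ?nnegrE.
apply: le_trans (vK L) _; apply: ler_pM; rewrite ?exprn_ge0 ?mulr_ge0//.
by rewrite lerXn2r ?nnegrE ?mulr_ge0// ler_wpM2r.
Qed.

Lemma sum_cauchy a b x L :
  \sum_(k < L) (\sum_(p < k.+1) a p * b (k - p)%N) * x ^+ k
  = \sum_(i < L) a i * x ^+ i * \sum_(k < L - i) b k * x ^+ k.
Proof.
elim: L => [|L IH]; first by rewrite !big_ord0.
rewrite big_ord_recr /= IH [RHS]big_ord_recr /=.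
rewrite subSnn big_ord1 mulr_suml big_ord_recr /= subnn addrA; congr (_ + _).
  rewrite -big_split /=; apply: eq_bigr => i _.
  rewrite subSn ?(ltnW (ltn_ord i))// big_ord_recr /= mulrDr; congr (_ + _).
  have -> : x ^+ L = x ^+ i * x ^+ (L - i).
    by rewrite -exprD subnKC// ltnW.
  ring.
by rewrite expr0 mulr1 mulrAC.
Qed.

(** The remainder of order L splits into the terms a_i x^i times the remainder of order L - i of v',
    and the remainder of order L of v times v' itself. Together they are dominated by the sum of the
    (S x)^i (S' x)^(L - i), hence by (S x + S' x)^L. *)
Lemma expansionM v x a K S v' a' K' S' : 0 <= x -> 0 <= S -> 0 <= S' ->
  expansion v x a K S -> expansion v' x a' K' S' ->
  expansion (v * v') x (fun k => \sum_(p < k.+1) a p * a' (k - p)%N)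
    (K * K') (S + S').
Proof.
move=> x0 S0 S'0 va va'.
have K0 := expansion_ge0 va; have K'0 := expansion_ge0 va'.
case: va va' => aK vK [aK' vK']; split=> [k|L].
  apply: le_trans (ler_norm_sum _ _ _) _.
  apply: le_trans (ler_wpM2l (mulr_ge0 K0 K'0) (sum_expr_le k S0 S'0)).
  rewrite mulr_sumr; apply: ler_sum => i _; rewrite normrM.
  by apply: le_trans (ler_pM _ _ (aK i) (aK' _)) _; rewrite // mulrACA.
rewrite sum_cauchy.
have -> : v * v' - \sum_(i < L) a i * x ^+ i * \sum_(k < L - i) a' k * x ^+ k
  = \sum_(i < L) a i * x ^+ i * (v' - \sum_(k < L - i) a' k * x ^+ k)
    + (v - \sum_(i < L) a i * x ^+ i) * (v' - \sum_(k < L - L) a' k * x ^+ k).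
  under [X in _ = X + _]eq_bigr => i _ do rewrite mulrBr.
  rewrite sumrB -mulr_suml subnn big_ord0 subr0; ring.
apply: le_trans (ler_normD _ _) _.
rewrite [(S + S') * x]mulrDl.
have Sx0 : 0 <= S * x by rewrite mulr_ge0.
have S'x0 : 0 <= S' * x by rewrite mulr_ge0.
apply: le_trans (ler_wpM2l (mulr_ge0 K0 K'0) (sum_expr_le L Sx0 S'x0)).
rewrite big_ord_recr /= [leRHS]mulrDr lerD//; last first.
  rewrite normrM.
  by apply: le_trans (ler_pM _ _ (vK _) (vK' _)) _; rewrite // mulrACA.
apply: le_trans (ler_norm_sum _ _ _) _.
rewrite mulr_sumr; apply: ler_sum => i _.
rewrite normrM mulrACA; apply: ler_pM; rewrite ?normr_ge0 ?vK'//.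
by rewrite normrM normrX (ger0_norm x0) exprMn mulrA ler_wpM2r ?exprn_ge0.
Qed.

(** The remainder of the geometric series is exactly (j x)^L times its sum, which therefore serves
    as the constant K. *)
Lemma expansion_geom x (j : nat) : 0 <= x -> j%:R * x < 1 ->
  expansion (1 - j%:R * x)^-1 x (fun k => (j ^ k)%:R) (1 - j%:R * x)^-1 j%:R.
Proof.
move=> x0 jx1; have d0 : 0 < 1 - j%:R * x by rewrite subr_gt0.
split=> [k|L].
  rewrite ger0_norm ?ler0n// natrX ler_peMl ?exprn_ge0 ?ler0n//.
  by rewrite invf_ge1// gerBl mulr_ge0 ?ler0n.
have -> : \sum_(k < L) (j ^ k)%:R * x ^+ k
    = (1 - (j%:R * x) ^+ L) / (1 - j%:R * x).
  have -> : 1 - (j%:R * x) ^+ L = - ((j%:R * x) ^+ L - 1) by rewrite opprB.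
  rewrite subrX1 -mulNr opprB mulrC mulKf ?gt_eqF//.
  by apply: eq_bigr => k _; rewrite natrX exprMn.
rewrite mulrBl mul1r subKr normrM mulrC !ger0_norm// ?exprn_ge0 ?mulr_ge0//.
by rewrite invr_ge0 ltW.
Qed.

(** By [expansionM] the constants K multiply to the product itself, and the rates add up to 0 + 1 +
    ... + (m - 1) <= m^2. *)
Lemma expansion_inv_prod x (m : nat) : 0 <= x -> m%:R * x < 1 ->
  let v := \prod_(i < m) (1 - i%:R * x)^-1 in
  expansion v x (fun k => (hsym_iota m k)%:R) v (m ^ 2)%:R.
Proof.
move=> x0; elim: m => [|m IH] mx1 /=.
  rewrite big_ord0.
  (* With no factors S = 0, and the bounds of order 0 rely on 0^0 = 1. *)
  split=> [[|k]|[|L]]; rewrite /= ?normr1 ?normr0 ?expr0 ?mulr1//.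
    by rewrite big_ord0 subr0 normr1.
  rewrite big_ord_recl /= expr0 mulr1 big1 ?addr0 ?subrr ?normr0//.
    by rewrite mul0r exprS mul0r mulr0.
  by move=> i _; rewrite mul0r.
have mx1' : m%:R * x < 1.
  by apply: le_lt_trans mx1; rewrite ler_wpM2r// ler_nat.
rewrite big_ord_recr /=.
have /expansion_le := expansionM x0 (ler0n _ _) (ler0n _ _) (IH mx1')
  (expansion_geom x0 mx1').
move=> /(_ _ (m.+1 ^ 2)%:R x0 _ (lexx _)) [].
- by rewrite addr_ge0 ?ler0n.
- by rewrite -natrD ler_nat; lia.
have hE k : (\sum_(i < k.+1) hsym_iota m i * m ^ (k - i))%:R
    = \sum_(p < k.+1) (hsym_iota m p)%:R * (m ^ (k - p))%:R :> F.
  by rewrite natr_sum; apply: eq_bigr => p _; rewrite natrM.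
move=> hK hL; split=> [k|L]; first by rewrite hE.
by under [X in _ - X]eq_bigr => k _ do rewrite hE.
Qed.

Lemma sum_geom2 (y : F) L n : 0 <= y -> 2%:R * y <= 1 ->
  \sum_(i < n) y ^+ (L + i) <= 2%:R * y ^+ L.
Proof.
move=> y0 y1.
(* The added term 2 y^(L + n) dominates the rest of the series and makes the left side nonincreasing
   in n. *)
suff : \sum_(i < n) y ^+ (L + i) + 2%:R * y ^+ (L + n) <= 2%:R * y ^+ L.
  by apply: le_trans; rewrite lerDl mulr_ge0 ?ler0n ?exprn_ge0.
elim: n => [|n IH]; first by rewrite big_ord0 add0r addn0.
apply: le_trans IH; rewrite big_ord_recr /= -addrA lerD2l.
rewrite addnS exprS mulrA -[X in X + _]mul1r -mulrDl.
by rewrite ler_wpM2r ?exprn_ge0// -[leRHS]/(1 + 1 :> F) lerD2l.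
Qed.

(** The remainder is a tail dominated by a geometric series of ratio S x <= 1/2, which costs the
    factor 2. *)
Lemma expansion_poly x a K S D : 0 <= x -> 0 <= S -> 2%:R * (S * x) <= 1 ->
  (forall k, `|a k| <= K * S ^+ k) -> (forall k, (D < k)%N -> a k = 0) ->
  expansion (\sum_(k < D.+1) a k * x ^+ k) x a (2%:R * K) S.
Proof.
move=> x0 S0 Sx aK aD.
have K0 : 0 <= K by have := le_trans (normr_ge0 _) (aK 0); rewrite expr0 mulr1.
split=> [k|L].
  apply: le_trans (aK k) _; rewrite ler_wpM2r ?exprn_ge0//.
  by rewrite ler_peMl// ler1n.
(* Zero terms are appended so that the sum can be split at L even when L > D. *)
have -> : \sum_(k < D.+1) a k * x ^+ k = \sum_(k < L + D.+1) a k * x ^+ k.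
  rewrite [in RHS]addnC big_split_ord /= [X in _ + X]big1 ?addr0// => i _.
  by rewrite aD ?mul0r// ltnS leq_addr.
rewrite big_split_ord /= [_ + \sum_(i < D.+1) _]addrC addrK.
apply: le_trans (ler_norm_sum _ _ _) _.
rewrite -mulrA mulrCA.
apply: le_trans (ler_wpM2l K0 (sum_geom2 L D.+1 (mulr_ge0 S0 x0) Sx)).
rewrite mulr_sumr; apply: ler_sum => i _.
rewrite normrM normrX (ger0_norm x0) exprMn mulrA.
by rewrite ler_wpM2r ?exprn_ge0.
Qed.

Lemma le2sqr_lt1 x m : 0 <= x -> 2%:R * ((m ^ 2)%:R * x) <= 1 -> m%:R * x < 1.
Proof.
move=> x0 mx; apply: (@le_lt_trans _ _ 2%:R^-1); last first.
  by rewrite invf_lt1 ?ltr0n// ltr1n.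
rewrite -[leRHS]mul1r ler_pdivlMr ?ltr0n// mulrC (le_trans _ mx)//.
rewrite ler_wpM2l ?ler0n// ler_wpM2r// ler_nat -mulnn.
by case: (m) => // k; rewrite leq_pmulr.
Qed.

(** A Bernoulli inequality: the product of the 1 - i x is at least 1 - m^2 x, hence at least 1/2. *)
Lemma inv_prod_le2 x m : 0 <= x -> 2%:R * ((m ^ 2)%:R * x) <= 1 ->
  \prod_(i < m) (1 - i%:R * x)^-1 <= 2%:R.
Proof.
move=> x0 mx; have mx1 := le2sqr_lt1 x0 mx.
have H : forall k, (k <= m)%N ->
    1 - (k ^ 2)%:R * x <= \prod_(i < k) (1 - i%:R * x) /\
    0 <= \prod_(i < k) (1 - i%:R * x) <= 1.
  elim=> [_|k IH km]; first by rewrite big_ord0 mul0r subr0 lexx ler01.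
  have [h1 /andP[h2 h3]] := IH (ltnW km).
  have kx1 : k%:R * x <= 1.
    by rewrite (le_trans _ (ltW mx1))// ler_wpM2r// ler_nat ltnW.
  have kx0 : 0 <= k%:R * x by rewrite mulr_ge0 ?ler0n.
  rewrite big_ord_recr /=; split; last first.
    by rewrite mulr_ge0 ?subr_ge0//= mulr_ile1 ?subr_ge0// gerBl.
  rewrite mulrBr mulr1 (le_trans _ (lerB h1 (ler_piMl kx0 h3)))//.
  rewrite -addrA -opprD -mulrDl -natrD lerD2l lerN2 ler_wpM2r// ler_nat; lia.
have [h1 _] := H m (leqnn m).
have h2 : 2%:R^-1 <= \prod_(i < m) (1 - i%:R * x).
  apply: le_trans h1; rewrite lerBrDr -lerBrDl.
  rewrite -ler_pdivlMl ?ltr0n// mulr1 in mx; apply: le_trans mx _.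
  by rewrite lerBrDl -[leLHS]mulr2n -[leLHS]mulr_natl mulfV ?pnatr_eq0.
rewrite prodfV -[leRHS]invrK lef_pV2// ?posrE ?invr_gt0 ?ltr0n//.
by apply: lt_le_trans h2; rewrite invr_gt0 ltr0n.
Qed.

(** The constant 4 is 2 from [expansion_poly] times 2 from [inv_prod_le2]; the rate 2 m^2 is m^2 +
    m^2, since [expansionM] adds rates. *)
Lemma expansion_ratio_coef M mu x m : (forall i, `|mu i| <= M ^+ i.+1) ->
  0 <= x -> 2%:R * ((m ^ 2)%:R * x) <= 1 ->
  expansion
    ((\sum_(p < m.+1) expN_coef (fun m => m%:R^-1) mu (m - p) m * x ^+ p)
     * \prod_(i < m) (1 - i%:R * x)^-1)
    x (fun k => ratio_coef (fun m => m%:R^-1) mu k m)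
    (4%:R * (M ^+ m / m`!%:R)) (2 * m ^ 2)%:R.
Proof.
move=> muM x0 mx; have M0 : 0 <= M by rewrite (le_trans _ (muM 0)) ?normr_ge0.
pose s p := if (p <= m)%N then expN_coef (fun m => m%:R^-1) mu (m - p) m else 0.
have K0 : 0 <= M ^+ m / m`!%:R by rewrite divr_ge0 ?exprn_ge0 ?ler0n.
have sK k : `|s k| <= M ^+ m / m`!%:R * (m ^ 2)%:R ^+ k.
  rewrite /s; case: ifP => [km|_].
    by apply: le_trans (norm_expN_coef muM _) _; rewrite ?leq_subr ?subKn.
  by rewrite normr0 mulr_ge0 ?exprn_ge0 ?ler0n.
have sm k : (m < k)%N -> s k = 0 by rewrite /s ltnNge => /negbTE ->.
have e1 := expansion_poly x0 (ler0n _ _) mx sK sm.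
have e2 := expansion_inv_prod x0 (le2sqr_lt1 x0 mx).
have := expansionM x0 (ler0n _ _) (ler0n _ _) e1 e2.
have -> : \sum_(p < m.+1) expN_coef (fun m => m%:R^-1) mu (m - p) m * x ^+ p
    = \sum_(k < m.+1) s k * x ^+ k.
  by apply: eq_bigr => p _; rewrite /s -ltnS ltn_ord.
apply: expansion_le; rewrite ?addr_ge0 ?ler0n//.
  rewrite [leLHS]mulrAC ler_wpM2r//.
  rewrite (_ : 4%:R = 2%:R * 2%:R); last by rewrite -natrM.
  by rewrite ler_wpM2l ?ler0n ?inv_prod_le2.
by rewrite mul2n -addnn natrD.
Qed.

Lemma norm_ratio_coef M mu k m : (forall i, `|mu i| <= M ^+ i.+1) ->
  `|ratio_coef (fun m => m%:R^-1) mu k m|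
    <= 4%:R * (M ^+ m / m`!%:R) * (2 * m ^ 2)%:R ^+ k.
Proof.
(* The coefficients of the expansion do not depend on [x]: take [x = 0]. *)
by move=> muM; case: (@expansion_ratio_coef M mu 0 m); rewrite ?mulr0 ?ler01.
Qed.

(** * The normalised coefficients u_m and their remainders *)

Lemma ffact_natr (N m : nat) : (m <= N)%N -> (0 < N)%N ->
  (N ^_ m)%:R = N%:R ^+ m * \prod_(i < m) (1 - i%:R / N%:R) :> F.
Proof.
move=> + N0; elim: m => [|m IH] mN; first by rewrite big_ord0 mulr1.
have mN' := ltnW mN.
rewrite ffactnSr natrM (IH mN').
rewrite (natrB _ mN').
rewrite exprSr big_ord_recr /=.
have -> : N%:R - m%:R = N%:R * (1 - m%:R / N%:R) :> F.
  by rewrite mulrBr mulr1 mulrCA mulfV ?mulr1// pnatr_eq0 -lt0n.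
by rewrite mulrACA mulrA.
Qed.

Lemma coef_prod_ratio mu rs m : let N := size rs in (0 < N)%N ->
  (m <= N)%N ->
  (forall i, \sum_(r <- rs) r ^+ i.+1 = N%:R * mu i) ->
  (\prod_(r <- rs) (1 + r *: 'X : {poly F}))`_m / (N ^_ m)%:R
  = (\sum_(p < m.+1) expN_coef (fun m => m%:R^-1) mu (m - p) m * N%:R^-1 ^+ p)
     * \prod_(i < m) (1 - i%:R * N%:R^-1)^-1.
Proof.
move=> N N0 mN muE; rewrite (coef_prod_1DZX m muE) ffact_natr//.
rewrite prodfV invfM mulrA; congr (_ * _).
(* Reversing the sum, j = m - p, turns N^j / N^m into N^(-p). *)
rewrite (reindex_inj rev_ord_inj) mulr_suml; apply: eq_bigr => p _ /=.
have pm : (p <= m)%N by rewrite -ltnS.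
have -> : N%:R^-1 ^+ p = N%:R ^+ (m - p) / N%:R ^+ m :> F.
  rewrite -[in X in _ / X](subnK pm) exprD invfM mulrA mulfV ?mul1r ?exprVn//.
  by rewrite expf_neq0// pnatr_eq0 -lt0n.
by rewrite subSS mulrAC mulrC.
Qed.

(* If [m > N] then [N ^_ m = 0] and the quotient is 0. *)
Lemma norm_coef_prod_ratio M rs m : let N := size rs in 0 <= M ->
  {in rs, forall r, `|r| <= M} ->
  `|(\prod_(r <- rs) (1 + r *: 'X : {poly F}))`_m / (N ^_ m)%:R|
  <= M ^+ m / m`!%:R.
Proof.
move=> N M0 rsM; rewrite normrM normfV [`|_%:R|]ger0_norm ?ler0n//.
have [mN|Nm] := leqP m N; last first.
  by rewrite ffact_small// invr0 mulr0 divr_ge0 ?exprn_ge0 ?ler0n.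
rewrite ler_pdivrMr ?ltr0n ?ffact_gt0//.
apply: le_trans (norm_coef_prod_1DZX m M0 rsM) _.
rewrite -/N -mulr_natr -mulrA ler_wpM2l ?exprn_ge0// -bin_ffact natrM.
by rewrite [leRHS]mulrC mulfK// pnatr_eq0 -lt0n fact_gt0.
Qed.

(** Serves to replace (2 m^2)^L by (4^L)^m, a geometric factor in m that 1 / m! absorbs. *)
Lemma sqr2_le_4expn m : (2 * m ^ 2 <= 4 ^ m)%N.
Proof.
case: m => // m; have : (m.+1 <= 2 ^ m)%N by rewrite ltn_expl.
rewrite -[4%N]/(2 ^ 2)%N -expnM (mulnC 2 m.+1) expnM (expnS 2) -!mulnn.
by move: (2 ^ m)%N => t mt; have := leq_mul mt mt; lia.
Qed.

(** With y = 2 m^2 / N, the case y <= 1 is [expansion_ratio_coef]. For y > 1 the quotient and the L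
    terms of the sum are bounded separately by multiples of y^L, with total constant 1 + 4 L <= 4 (L
    + 1). *)
Lemma coef_prod_expansion M mu rs m L : let N := size rs in (0 < N)%N ->
  (forall i, \sum_(r <- rs) r ^+ i.+1 = N%:R * mu i) ->
  (forall i, `|mu i| <= M ^+ i.+1) -> {in rs, forall r, `|r| <= M} ->
  `|(\prod_(r <- rs) (1 + r *: 'X : {poly F}))`_m / (N ^_ m)%:R
    - \sum_(k < L) ratio_coef (fun m => m%:R^-1) mu k m * N%:R^-1 ^+ k|
  <= (4 * L.+1)%:R * ((4 ^ L)%:R * M) ^+ m / m`!%:R * N%:R^-1 ^+ L.
Proof.
move=> N N0 muE muM rsM.
have M0 : 0 <= M by rewrite (le_trans _ (muM 0)) ?normr_ge0.
have K0 : 0 <= M ^+ m / m`!%:R by rewrite divr_ge0 ?exprn_ge0 ?ler0n.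
pose y : F := (2 * m ^ 2)%:R * N%:R^-1.
have x0 : 0 <= N%:R^-1 :> F by rewrite invr_ge0 ler0n.
have y0 : 0 <= y by rewrite mulr_ge0 ?ler0n.
apply: (@le_trans _ _ ((4 * L.+1)%:R * (M ^+ m / m`!%:R) * y ^+ L)); last first.
  rewrite /y [(_ * N%:R^-1) ^+ L]exprMn [leLHS]mulrA ler_wpM2r ?exprn_ge0//.
  rewrite -!mulrA ler_wpM2l ?ler0n//.
  rewrite exprMn -[leRHS]mulrA [leRHS]mulrCA ler_wpM2l ?exprn_ge0//.
  rewrite [leLHS]mulrC ler_wpM2r ?invr_ge0 ?ler0n// -!natrX ler_nat expnAC.
  by case: (L) => // l; rewrite leq_exp2r ?sqr2_le_4expn.
have [mN|Nm] := leqP (2 * m ^ 2) N.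
  have mx : 2%:R * ((m ^ 2)%:R * N%:R^-1) <= 1 :> F.
    by rewrite mulrA -natrM ler_pdivrMr ?ltr0n// mul1r ler_nat.
  have [_ /(_ L)] := expansion_ratio_coef muM x0 mx.
  rewrite -coef_prod_ratio//; last by nia.
  move=> /le_trans -> //; rewrite ler_wpM2r ?exprn_ge0// ler_wpM2r// ler_nat.
  by rewrite leq_pmulr.
have y1 : 1 <= y by rewrite ler_pdivlMr ?ltr0n// mul1r ler_nat ltnW.
apply: le_trans (ler_normB _ _) _.
apply: (@le_trans _ _ (M ^+ m / m`!%:R * y ^+ L
   + (4 * L)%:R * (M ^+ m / m`!%:R) * y ^+ L)); last first.
  rewrite -mulrDl ler_wpM2r ?exprn_ge0// mulnS natrD mulrDl lerD2r.
  by rewrite ler_peMl// ler1n.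
apply: lerD.
  by rewrite (le_trans (norm_coef_prod_ratio m M0 rsM))// ler_peMr// exprn_ege1.
apply: le_trans (ler_norm_sum _ _ _) _.
have -> : (4 * L)%:R * (M ^+ m / m`!%:R) * y ^+ L
    = \sum_(k < L) 4%:R * (M ^+ m / m`!%:R) * y ^+ L.
  by rewrite sumr_const card_ord -[RHS]mulr_natl natrM; ring.
apply: ler_sum => k _; rewrite normrM normrX (ger0_norm x0).
apply: le_trans (ler_wpM2r (exprn_ge0 _ x0) (norm_ratio_coef k m muM)) _.
rewrite -[leLHS]mulrA -exprMn -/y ler_wpM2l//.
  by rewrite (mulr_ge0 (ler0n _ 4)).
by rewrite ler_weXn2l// ltnW.
Qed.

End Estimates.

(** * Complex power series *)

Section ComplexSeries.
Variable R : realType.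
Implicit Types (z w h : R[i]) (t a : nat -> R[i]).

Lemma ge0_complexE z : 0 <= z -> z = (complex.Re z)%:C.
Proof. by move=> z0; rewrite RRe_real// ger0_real. Qed.

Lemma normc_Re_le z : `|complex.Re z|%:C <= `|z|.
Proof.
rewrite normc_def lecR -sqrtr_sqr ler_wsqrtr// lerDl sqr_ge0//.
Qed.

Lemma normc_Im_le z : `|complex.Im z|%:C <= `|z|.
Proof.
rewrite normc_def lecR -sqrtr_sqr ler_wsqrtr// lerDr sqr_ge0//.
Qed.

Lemma normc_le_ReIm z : `|z| <= `|complex.Re z|%:C + `|complex.Im z|%:C.
Proof.
rewrite {1}[z]complexE (le_trans (ler_normD _ _))// normrM.
have -> : `|'i%C| = 1 :> R[i].
  by rewrite normc_def /= expr0n expr1n add0r sqrtr1.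
by rewrite mul1r !normc_def /= !expr0n !addr0 !sqrtr_sqr.
Qed.

Lemma sum_expr_fact_bounded (rho : R[i]) : 0 <= rho ->
  exists B : R[i], forall J, \sum_(j < J) rho ^+ j / j`!%:R <= B.
Proof.
move=> /ge0_complexE ->.
have /cvg_seq_bounded/bounded_fun_has_ubound[B HB] :=
  @is_cvg_series_exp_coeff R (complex.Re rho).
exists B%:C => J; have /HB : range (series (exp_coeff (complex.Re rho)))
  (series (exp_coeff (complex.Re rho)) J) by exists J.
rewrite -lecR; congr (_ <= _); rewrite /series /= big_mkord rmorph_sum.
by apply: eq_bigr => j _; rewrite rmorphM rmorphXn fmorphV rmorph_nat.
Qed.

Lemma cvg_complex (s : nat -> R[i]) (x y : R) :
  (complex.Re (R := R) \o s) @ \oo --> x ->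
  (complex.Im (R := R) \o s) @ \oo --> y ->
  (s : nat -> R[i]^o) @ \oo --> (x +i* y : R[i]^o).
Proof.
move=> sx sy; apply/cvgrPdist_le => e e0.
have eE := ge0_complexE (ltW e0).
have e20 : 0 < complex.Re e / 2.
  by rewrite divr_gt0// -ltcR -eE.
move/cvgrPdist_le : sx => /(_ _ e20) sx.
move/cvgrPdist_le : sy => /(_ _ e20) sy.
near=> n.
have xn : `|x - complex.Re (s n)| <= complex.Re e / 2 by near: n.
have yn : `|y - complex.Im (s n)| <= complex.Re e / 2 by near: n.
apply: le_trans (normc_le_ReIm _) _.
rewrite eE [complex.Re e]splitr rmorphD /= lerD//.
  by case: (s n) xn => a b /=; rewrite lecR.
by case: (s n) yn => a b /=; rewrite lecR.
Unshelve. all: by end_near. Qed.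

(** Real and imaginary parts are each dominated by a multiple of the exponential series of [rho],
    hence converge absolutely. *)
Lemma majorant_cvg t (K rho : R[i]) : 0 <= rho ->
  (forall j, `|t j| <= K * rho ^+ j / j`!%:R) ->
  exists l : R[i], series (t : nat -> R[i]^o) @ \oo --> (l : R[i]^o).
Proof.
move=> rho0 tK.
have K0 : 0 <= K.
  by have := le_trans (normr_ge0 _) (tK 0%N); rewrite expr0 fact0 divr1 mulr1.
have tK' j : `|t j| <= (complex.Re K * exp_coeff (complex.Re rho) j)%:C.
  apply: le_trans (tK j) _.
  by rewrite (ge0_complexE K0) (ge0_complexE rho0) /exp_coeff /= -mulrA
    rmorphM rmorphM rmorphXn fmorphV rmorph_nat.
have maj_cvg :
    cvgn (series (fun j => complex.Re K * exp_coeff (complex.Re rho) j)).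
  have -> : series (fun j => complex.Re K * exp_coeff (complex.Re rho) j)
      = complex.Re K *: series (exp_coeff (complex.Re rho)).
    by apply/funext => n; rewrite /series /= -mulr_sumr.
  by apply: is_cvgZr; exact: is_cvg_series_exp_coeff.
have part_cvg (p : R[i] -> R) : (forall z, `|p z|%:C <= `|z|) ->
    cvgn (series (p \o t)).
  move=> pz; apply: normed_cvg; apply: series_le_cvg maj_cvg => n //=.
    by rewrite -lecR; exact: le_trans (normr_ge0 _) (tK' n).
  by rewrite -lecR (le_trans (pz _)).
have cRe := part_cvg (@complex.Re R) normc_Re_le.
have cIm := part_cvg (@complex.Im R) normc_Im_le.
exists (limn (series (@complex.Re R \o t)) +i*
        limn (series (@complex.Im R \o t))).
apply: cvg_complex.
  rewrite (_ : _ \o _ = series (@complex.Re R \o t))//.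
  apply/funext => n /=.
  by rewrite /series /= (raddf_sum (@complex.Re R)).
rewrite (_ : _ \o _ = series (@complex.Im R \o t))//.
apply/funext => n /=.
by rewrite /series /= (raddf_sum (@complex.Im R)).
Qed.

Lemma cvg_norm_le (s : nat -> R[i]) (l w B : R[i]) :
  (s : nat -> R[i]^o) @ \oo --> (l : R[i]^o) ->
  (\forall n \near \oo, `|s n - w| <= B) -> `|l - w| <= B.
Proof.
move=> sl sB; apply/ler_addgt0Pr => e e0.
move/cvgrPdist_le : sl => /(_ _ e0) sl.
near \oo => n.
have -> : l - w = (s n - w) + (l - s n) by ring.
rewrite (le_trans (ler_normD _ _))// lerD//; by near: n.
Unshelve. all: by end_near. Qed.

Lemma cvg_mulc (s : nat -> R[i]) (l c : R[i]) :
  (s : nat -> R[i]^o) @ \oo --> (l : R[i]^o) ->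
  (fun n => c * s n : R[i]^o) @ \oo --> (c * l : R[i]^o).
Proof. by move=> sl; have := cvgZl_tmp (k := c) sl; apply. Qed.

Lemma cvg_subc (s s' : nat -> R[i]) (l l' : R[i]) :
  (s : nat -> R[i]^o) @ \oo --> (l : R[i]^o) ->
  (s' : nat -> R[i]^o) @ \oo --> (l' : R[i]^o) ->
  (fun n => s n - s' n : R[i]^o) @ \oo --> (l - l' : R[i]^o).
Proof.
move=> /cvgrPdist_le sl /cvgrPdist_le sl'; apply/cvgrPdist_le => e e0.
have e20 : 0 < e / 2%:R by rewrite divr_gt0.
have {}sl := sl _ e20; have {}sl' := sl' _ e20.
near=> n.
have -> : l - l' - (s n - s' n) = (l - s n) - (l' - s' n) :> R[i] by ring.
rewrite (le_trans (ler_normB _ _))// [leRHS](splitr e) lerD//; by near: n.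
Unshelve. all: by end_near. Qed.

(** A second-order Taylor remainder with crude constants: the induction only needs j^2 + j <= (j +
    1)^2. *)
Lemma norm_expr_diff2 z h w j : `|z| + `|h| <= w -> 1 <= w ->
  `|(z + h) ^+ j - z ^+ j - h * (j%:R * z ^+ j.-1)|
    <= `|h| ^+ 2 * (j ^ 2)%:R * w ^+ j.
Proof.
move=> zhw w1; have w0 : 0 <= w := le_trans ler01 w1.
have zw : `|z| <= w by rewrite (le_trans _ zhw)// lerDl.
elim: j => [|j IH].
  by rewrite !expr0 subrr mul0r mulr0 subr0 normr0 mulr0 mul0r.
have -> : (z + h) ^+ j.+1 - z ^+ j.+1 - h * (j.+1%:R * z ^+ j.+1.-1)
   = (z + h) * ((z + h) ^+ j - z ^+ j - h * (j%:R * z ^+ j.-1))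
     + h ^+ 2 * (j%:R * z ^+ j.-1).
  case: j {IH} => [|j]; rewrite /= ?exprS; ring.
apply: le_trans (ler_normD _ _) _.
apply: (@le_trans _ _ (w * (`|h| ^+ 2 * (j ^ 2)%:R * w ^+ j)
    + `|h| ^+ 2 * (j%:R * w ^+ j.+1))).
  apply: lerD.
    by rewrite normrM ler_pM// (le_trans (ler_normD _ _)).
  rewrite !normrM normrX ler_wpM2l ?exprn_ge0// [`|_%:R|]ger0_norm ?ler0n//.
  rewrite ler_wpM2l ?ler0n// ?normrX.
  apply: (@le_trans _ _ (w ^+ j.-1)); first by rewrite lerXn2r ?nnegrE.
  by rewrite ler_weXn2l//; lia.
have -> : w * (`|h| ^+ 2 * (j ^ 2)%:R * w ^+ j) + `|h| ^+ 2 * (j%:R * w ^+ j.+1)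
    = `|h| ^+ 2 * (j ^ 2 + j)%:R * w ^+ j.+1.
  by rewrite natrD [w ^+ j.+1]exprS; ring.
by rewrite ler_wpM2r ?exprn_ge0// ler_wpM2l ?exprn_ge0// ler_nat; lia.
Qed.

Lemma sqr_le_4expn (m : nat) : (m ^ 2 <= 4 ^ m)%N.
Proof. by apply: leq_trans (sqr2_le_4expn m); rewrite leq_pmull. Qed.

(** The series derived term by term converges to some l, and summing [norm_expr_diff2] bounds f(z +
    h) - f(z) - h l by a multiple of |h|^2. The factors j^2 are absorbed into 4^j. *)
Lemma entire_series f a (K rho : R[i]) : 0 <= rho ->
  (forall j, `|a j| <= K * rho ^+ j / j`!%:R) -> has_coefs f a -> entire f.
Proof.
move=> rho0 aK fa z.
have K0 : 0 <= K.
  by have := le_trans (normr_ge0 _) (aK 0%N); rewrite expr0 fact0 divr1 mulr1.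
(* Chosen so that |z| + |h| <= w whenever |h| <= 1. *)
pose w : R[i] := `|z| + 1.
have w1 : 1 <= w by rewrite lerDr.
have w0 : 0 <= w := le_trans ler01 w1.
have zw : `|z| <= w by rewrite lerDl.
have r0 : 0 <= 4%:R * w * rho by rewrite !mulr_ge0.
have [l cl] : exists l : R[i],
    series (fun j => a j * (j%:R * z ^+ j.-1) : R[i]^o) @ \oo --> (l : R[i]^o).
  apply: (majorant_cvg r0 (K := K)) => j; rewrite normrM.
  apply: le_trans (ler_wpM2r _ (aK j)) _ => //.
  have -> : K * (4%:R * w * rho) ^+ j / j`!%:R
      = K * rho ^+ j / j`!%:R * (4%:R ^+ j * w ^+ j) by rewrite !exprMn; ring.
  rewrite ler_wpM2l//; first exact: le_trans (normr_ge0 _) (aK j).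
  rewrite normrM [`|_%:R|]ger0_norm ?ler0n//; apply: ler_pM => //.
    rewrite -natrX ler_nat (leq_trans _ (sqr_le_4expn j))//.
    by case: j => // j; rewrite -mulnn leq_pmulr.
  rewrite normrX; apply: (@le_trans _ _ (w ^+ j.-1)).
    by rewrite lerXn2r ?nnegrE.
  by rewrite ler_weXn2l//; lia.
have [B HB] := sum_expr_fact_bounded r0.
have B0 : 0 <= B by have := HB 0%N; rewrite big_ord0.
have KB0 : 0 <= K * B by rewrite mulr_ge0.
have diff2 h : `|h| <= 1 -> `|f (z + h) - f z - h * l| <= `|h| ^+ 2 * (K * B).
  move=> h1.
  have zhw : `|z| + `|h| <= w by rewrite lerD2l.
  rewrite -[X in `|X|]subr0.
  apply: (cvg_norm_le (cvg_subc (cvg_subc (fa (z + h)) (fa z))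
    (cvg_mulc (c := h) cl))).
  near=> J; rewrite subr0 /series /= !big_mkord mulr_sumr -!sumrB.
  apply: le_trans (ler_norm_sum _ _ _) _.
  apply: (le_trans _ (ler_wpM2l _ (ler_wpM2l K0 (HB J)))); last first.
    by rewrite exprn_ge0.
  rewrite !mulr_sumr; apply: ler_sum => j _.
  rewrite mulrCA -!mulrBr normrM.
  apply: le_trans (ler_pM _ _ (aK j) (norm_expr_diff2 j zhw w1)) _ => //.
  have -> : `|h| ^+ 2 * (K * ((4%:R * w * rho) ^+ j / j`!%:R))
      = K * rho ^+ j / j`!%:R * (`|h| ^+ 2 * 4%:R ^+ j * w ^+ j).
    by rewrite !exprMn; ring.
  rewrite ler_wpM2l//; first exact: le_trans (normr_ge0 _) (aK j).
  rewrite ler_wpM2r ?exprn_ge0// ler_wpM2l ?exprn_ge0// -natrX ler_nat.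
  exact: sqr_le_4expn.
apply/cvg_ex; exists (l : R[i]^o); apply/cvgrPdist_le => e e0.
(* The added 1 keeps the denominator positive even if K B = 0. *)
have d0 : 0 < e / (K * B + 1) by rewrite divr_gt0// ltr_wpDl.
near=> h.
have h0 : h != 0 by near: h; exact: nbhs_dnbhs_neq.
have h1 : `|h| <= 1 by near: h; apply: dnbhs0_le; exact: ltr01.
have hd : `|h| <= e / (K * B + 1) by near: h; exact: dnbhs0_le.
have -> : h^-1 *: ((f \o shift z) (h *: 1) - f z) = h^-1 * (f (z + h) - f z).
  by rewrite /= /shift /= [h *: 1]mulr1 [h + z]addrC.
rewrite distrC -(mulKf h0 l) -mulrBr normrM normfV.
rewrite ler_pdivrMl ?normr_gt0// (le_trans (diff2 _ h1))// expr2 -mulrA.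
rewrite ler_wpM2l// mulrC.
apply: le_trans (ler_wpM2l KB0 hd) _.
by rewrite mulrCA ler_piMr ?(ltW e0)// ler_pdivrMr ?ltr_wpDl// mul1r lerDl.
Unshelve. all: by end_near. Qed.

End ComplexSeries.

(** * Laplace integrals of polynomials *)

Section Laplace.
Variable R : realType.
Implicit Types (x y c t C : R) (p q : {poly R}).

Lemma is_derive_mul c t : is_derive t 1 ( *%R c) c.
Proof.
have -> : ( *%R c) = c \*: (@id R) by [].
by apply: is_derive_eq; rewrite /GRing.scale /= mulr1.
Qed.

Lemma is_derive_expRM c t :
  is_derive t 1 (fun s => expR (c * s)) (c * expR (c * t)).
Proof.
have -> : (fun s => expR (c * s)) = expR \o ( *%R c) by [].
by have d1 := is_derive_mul c t; apply: is_derive_eq; rewrite mulrC.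
Qed.

Lemma is_derive_cosM c t :
  is_derive t 1 (fun s => cos (c * s)) (- (c * sin (c * t))).
Proof.
have -> : (fun s => cos (c * s)) = cos \o ( *%R c) by [].
by have d1 := is_derive_mul c t; apply: is_derive_eq; rewrite mulrC mulrN.
Qed.

Lemma is_derive_sinM c t :
  is_derive t 1 (fun s => sin (c * s)) (c * cos (c * t)).
Proof.
have -> : (fun s => sin (c * s)) = sin \o ( *%R c) by [].
by have d1 := is_derive_mul c t; apply: is_derive_eq; rewrite mulrC.
Qed.

Lemma cvg_expRN c : 0 < c -> expR (- c * t) @[t --> +oo] --> (0 : R).
Proof.
move=> c0; apply/cvgrPdist_le => e e0; near=> t.
rewrite sub0r normrN ger0_norm ?expR_ge0//.
have t0 : 0 < t by near: t; exact: nbhs_pinfty_gt.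
rewrite mulNr expRN -[leRHS]invrK lef_pV2 ?posrE ?invr_gt0 ?expR_gt0//.
apply: le_trans (expR_ge1Dx _).
rewrite -[leLHS]add0r lerD// mulrC -ler_pdivrMr//.
Unshelve. all: by end_near. Qed.

(* Both [g + C exp (- c t)] and [C exp (- c t)] are nonnegative, so the
   fundamental theorem for nonnegative integrands on a half-line applies to
   them. *)
Lemma Rintegral_expR_dominated_FTC2y (g G : R -> R) C c : 0 < c -> 0 <= C ->
  continuous g -> (forall t : R, is_derive t 1 G (g t)) ->
  (forall t, 0 <= t -> `|g t| <= C * expR (- c * t)) ->
  G t @[t --> +oo] --> (0 : R) ->
  \int[lebesgue_measure]_(t in `[0, +oo[) g t = - G 0.
Proof.
move=> c0 C0 cg dG gC G0.
pose E t := C * expR (- c * t).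
pose F t := - (C / c) * expR (- c * t).
have dF t : is_derive t 1 F (E t).
  have d1 := is_derive_expRM (- c) t.
  have -> : F = (- (C / c)) \*: (fun s => expR (- c * s)) by [].
  apply: is_derive_eq; rewrite /GRing.scale /= /E mulNr mulNr mulrN opprK mulrA.
  by rewrite divfK// gt_eqF.
have cE : continuous E.
  move=> t; apply: (@continuousM _ _ (cst C) (fun s => expR (- c * s))).
    exact: cvg_cst.
  apply/differentiable_continuous/derivable1_diffP.
  exact: (@ex_derive _ _ _ _ _ _ _ (is_derive_expRM (- c) t)).
have F0 : F t @[t --> +oo] --> (0 : R).
  rewrite -[X in _ --> X](mulr0 (- (C / c))).
  exact: (cvgZl_tmp (k := - (C / c)) (cvg_expRN c0)).
have ftc (h H : R -> R) : (forall t, 0 <= t -> 0 <= h t) -> continuous h ->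
    (forall t, is_derive t 1 H (h t)) -> H t @[t --> +oo] --> (0 : R) ->
    (\int[lebesgue_measure]_(t in `[0%R, +oo[) (h t)%:E)%E = (- H 0)%:E.
  move=> h0 ch dH H0; have /= := @ge0_continuous_FTC2y R h H 0 0 h0.
  rewrite -EFinB sub0r; apply.
  - exact: continuous_subspaceT.
  - exact: H0.
  - by move=> t _; exact: (@ex_derive _ _ _ _ _ _ _ (dH t)).
  - apply: cvg_at_right_filter.
    apply/differentiable_continuous/derivable1_diffP.
    exact: (@ex_derive _ _ _ _ _ _ _ (dH 0)).
  - by move=> t _; rewrite derive1E (@derive_val _ _ _ _ _ _ _ (dH t)).
have E_ge0 t : 0 <= E t by rewrite mulr_ge0 ?expR_ge0.
have intE := ftc E F (fun t _ => E_ge0 t) cE dF F0.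
have gE_ge0 t : 0 <= t -> 0 <= g t + E t.
  by move=> /gC; rewrite ler_norml => /andP[+ _]; rewrite -lerBlDr sub0r.
have cgE : continuous (fun t => g t + E t).
  by move=> t; apply: (@continuousD _ _ _ g E); [exact: cg|exact: cE].
have dGF t : is_derive t 1 (fun s => G s + F s) (g t + E t).
  by have := is_deriveD (dG t) (dF t); apply.
have GF0 : (G t + F t) @[t --> +oo] --> (0 : R).
  by rewrite -[X in _ --> X](addr0 0); apply: cvgD.
have intgE := ftc (fun t => g t + E t) (fun t => G t + F t) gE_ge0 cgE dGF GF0.
(* A finite integral of a nonnegative continuous function gives integrability, so that the integral
   of the difference can be split. *)
have integrable_of (h : R -> R) (v : R) :
    continuous h -> (forall t, 0 <= t -> 0 <= h t) ->
    (\int[lebesgue_measure]_(t in `[0%R, +oo[) (h t)%:E)%E = v%:E ->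
    lebesgue_measure.-integrable `[0, +oo[ (EFin \o h).
  move=> ch h0 hv; apply/integrableP; split.
    apply/measurable_EFinP/measurable_funTS.
    exact: continuous_measurable_fun.
  rewrite (_ : (\int[_]_(_ in _) _)%E = v%:E) ?ltry// -hv.
  apply: eq_integral => t; rewrite inE/= in_itv /= andbT => t0.
  by rewrite ger0_norm ?h0.
have -> : \int[lebesgue_measure]_(t in `[0, +oo[) g t
    = \int[lebesgue_measure]_(t in `[0, +oo[) ((g t + E t) - E t).
  by apply: eq_Rintegral => t _; rewrite addrK.
rewrite RintegralB//; last 2 first.
  exact: integrable_of cgE gE_ge0 intgE.
  exact: integrable_of cE (fun t _ => E_ge0 t) intE.
rewrite /Rintegral intgE intE /=; ring.
Qed.


(** Induction along Horner's scheme: half of the rate c bounds the shorter polynomial, the other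
    half the new factor t, by c t / 2 <= exp (c t / 2). *)
Lemma horner_expR_bound p c : 0 < c ->
  exists2 C, 0 <= C & forall t, 0 <= t -> `|p.[t]| <= C * expR (c * t).
Proof.
elim/poly_ind: p c => [|p k IH] c c0.
  by exists 0 => // t _; rewrite horner0 normr0 mul0r.
have c20 : 0 < c / 2 by rewrite divr_gt0.
have [C C0 HC] := IH _ c20.
exists (C * (c / 2)^-1 + `|k|).
  by rewrite addr_ge0// mulr_ge0// invr_ge0 ltW.
move=> t t0; rewrite hornerD hornerM hornerX hornerC.
rewrite (le_trans (ler_normD _ _))// mulrDl lerD//; last first.
  by rewrite ler_peMr// -expR0 ler_expR mulr_ge0// ltW.
have -> : expR (c * t) = expR (c / 2 * t) * expR (c / 2 * t).
  by rewrite -expRD -mulrDl -splitr.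
rewrite normrM (ger0_norm t0) mulrACA; apply: ler_pM => //; first exact: HC.
rewrite ler_pdivlMl// (le_trans _ (expR_ge1Dx _))// lerDr//.
Qed.

(* The real and imaginary parts of exp (- z t) P(t), for z = x + i y, are both
   of this form. *)
Definition osc x y p q t : R :=
  expR (- x * t) * (cos (y * t) * p.[t] + sin (y * t) * q.[t]).

(** For P = p + i q and z = x + i y, the new pair consists of the real and imaginary parts of P' - z
    P. *)
Lemma is_derive_osc x y p q t : is_derive t 1 (osc x y p q)
  (osc x y (p^`() - x *: p + y *: q) (q^`() - x *: q - y *: p) t).
Proof.
have d1 := is_derive_expRM (- x) t.
have d2 := is_derive_cosM y t.
have d3 := is_derive_sinM y t.
have d4 := is_deriveM d1 (is_deriveD (is_deriveM d2 (is_derive_poly p t))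
   (is_deriveM d3 (is_derive_poly q t))).
have -> : osc x y p q = (fun s => expR (- x * s)) *
   ((fun s => cos (y * s)) * horner p + (fun s => sin (y * s)) * horner q).
  by [].
apply: is_derive_eq.
by rewrite /osc !(hornerD, hornerN, hornerZ) /GRing.scale /= !fctE; ring.
Qed.

Lemma continuous_osc x y p q : continuous (osc x y p q).
Proof.
move=> t; apply/differentiable_continuous/derivable1_diffP.
exact: (@ex_derive _ _ _ _ _ _ _ (is_derive_osc x y p q t)).
Qed.

(** Half of the decay rate is spent on the growth of the polynomials. *)
Lemma osc_bound x y p q : 0 < x ->
  exists2 C, 0 <= C &
    forall t, 0 <= t -> `|osc x y p q t| <= C * expR (- (x / 2) * t).
Proof.
move=> x0; have x20 : 0 < x / 2 by rewrite divr_gt0.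
have [C C0 HC] := horner_expR_bound p x20.
have [D D0 HD] := horner_expR_bound q x20.
exists (C + D) => [|t t0]; first exact: addr_ge0.
have -> : expR (- (x / 2) * t) = expR (- x * t) * expR (x / 2 * t).
  by rewrite -expRD -mulrDl {2}[x]splitr opprD addrNK.
rewrite mulrCA normrM (ger0_norm (expR_ge0 _)) ler_wpM2l ?expR_ge0//.
rewrite (le_trans (ler_normD _ _))// mulrDl lerD// normrM.
  rewrite (le_trans _ (HC t t0))// ler_piMl// ler_norml cos_geN1 cos_le1//.
rewrite (le_trans _ (HD t t0))// ler_piMl// ler_norml sin_geN1 sin_le1//.
Qed.

Lemma osc_cvg0 x y p q : 0 < x -> osc x y p q t @[t --> +oo] --> (0 : R).
Proof.
move=> x0; have x20 : 0 < x / 2 by rewrite divr_gt0.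
have [C C0 HC] := osc_bound y p q x0.
have CE : C * expR (- (x / 2) * t) @[t --> +oo] --> (0 : R).
  rewrite -[X in _ --> X](mulr0 C).
  exact: (cvgZl_tmp (k := C) (cvg_expRN x20)).
apply/cvgrPdist_le => e e0; move/cvgrPdist_le : CE => /(_ _ e0) CE.
near=> t; rewrite sub0r normrN (le_trans (HC t _))//.
rewrite (le_trans (ler_norm _))// -normrN -sub0r; by near: t.
Unshelve. all: by end_near. Qed.

Lemma Rintegral_osc x y p q : 0 < x ->
  \int[lebesgue_measure]_(t in `[0, +oo[)
    osc x y (p^`() - x *: p + y *: q) (q^`() - x *: q - y *: p) t = - p.[0].
Proof.
move=> x0; have [C C0 HC] := osc_bound y (p^`() - x *: p + y *: q)
  (q^`() - x *: q - y *: p) x0.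
have x20 : 0 < x / 2 by rewrite divr_gt0.
rewrite (Rintegral_expR_dominated_FTC2y x20 C0 (@continuous_osc _ _ _ _)
  (is_derive_osc x y p q) HC (osc_cvg0 _ _ _ x0)).
by rewrite /osc !mulr0 expR0 cos0 sin0 mul0r addr0 !mul1r.
Qed.

(** * Complex polynomials against a complex exponential *)

Implicit Types (z : R[i]) (P V : {poly R[i]}).

Definition Re_poly P := map_poly (@complex.Re R) P.
Definition Im_poly P := map_poly (@complex.Im R) P.

Lemma horner_complex P t :
  P.[t%:C] = (Re_poly P).[t] +i* (Im_poly P).[t].
Proof.
have {1}-> : P = map_poly (real_complex R) (Re_poly P)
    + 'i%C *: map_poly (real_complex R) (Im_poly P).
  apply/polyP => i; rewrite coefD coefZ !coef_map /=; exact: complexE.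
by rewrite hornerD hornerZ !horner_map [RHS]complexE.
Qed.

Lemma deriv_Re_poly P : (Re_poly P)^`() = Re_poly P^`().
Proof.
apply/polyP => i; rewrite coef_deriv !coef_map coef_deriv.
by rewrite (raddfMn (@complex.Re R)).
Qed.

Lemma deriv_Im_poly P : (Im_poly P)^`() = Im_poly P^`().
Proof.
apply/polyP => i; rewrite coef_deriv !coef_map coef_deriv.
by rewrite (raddfMn (@complex.Im R)).
Qed.

(* [- exp (- z t) V(t)] is a primitive of [exp (- z t) P(t)]. *)
Lemma primitive_poly_exp z P : z != 0 ->
  let V := \sum_(j < size P) z ^- j.+1 *: P^`(j) in
  z *: V - V^`() = P /\ V.[0] = \sum_(j < size P) P`_j * j`!%:R / z ^+ j.+1.
Proof.
move=> z0 V; split.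
  rewrite /V scaler_sumr (raddf_sum (@deriv R[i])) -sumrB.
  (* The terms z^(-j) P^(j) telescope from P to the derivative of order [size P], which is 0. *)
  pose u j := - (z ^- j *: P^`(j)).
  rewrite (eq_bigr (fun j : 'I__ => u j.+1 - u j)); last first.
    move=> j _; rewrite /u opprK [RHS]addrC /= derivZ -derivnS; congr (_ - _).
    by rewrite scalerA exprS invfM mulrA mulfV// mul1r.
  rewrite -(big_mkord predT (fun j => u j.+1 - u j)) telescope_sumr//.
  rewrite /u opprK expr0 invr1 scale1r derivn0 derivn_poly0// scaler0 oppr0.
  by rewrite add0r.
rewrite horner_sum; apply: eq_bigr => j _.
rewrite hornerZ mulrC; congr (_ / _).
by rewrite horner_coef0 coef_derivn addn0 ffactnn mulr_natr.
Qed.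

Lemma cintegral_horner z P : 0 < complex.Re z ->
  cintegral0y (fun t : R => cexp (- z * t%:C) * P.[t%:C])
  = \sum_(j < size P) P`_j * j`!%:R / z ^+ j.+1.
Proof.
move=> x0; have z0 : z != 0 by apply: contraTneq x0 => ->; rewrite ltxx.
have [VP <-] := primitive_poly_exp P z0.
set V := \sum_(j < _) _ in VP *.
pose x := complex.Re z; pose y := complex.Im z.
(* Here a + i b = - V, so that exp (- z t) (a + i b)(t) is the primitive; its real part belongs to
   the pair (a, b), its imaginary part to (b, - a). *)
pose a := - Re_poly V; pose b := - Im_poly V.
have zE (t : R) : cexp (- z * t%:C)
    = (expR (- x * t) * cos (y * t)) +i* (- (expR (- x * t) * sin (y * t))).
  rewrite /cexp /x /y; case: (z) => u v /=.
  by rewrite !mulr0 subr0 add0r !mulNr cosN sinN mulrN.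
have expP (t : R) : cexp (- z * t%:C) * P.[t%:C]
    = osc x y (a^`() - x *: a + y *: b) (b^`() - x *: b - y *: a) t +i*
      osc x y (b^`() - x *: b + y *: - a) ((- a)^`() - x *: - a - y *: b) t.
  rewrite zE -VP hornerD hornerN hornerZ !horner_complex /osc /a /b.
  rewrite !derivN !opprK !deriv_Re_poly !deriv_Im_poly.
  rewrite !(hornerD, hornerN, hornerZ) -/x -/y.
  have -> : z = x +i* y by rewrite /x /y; case: (z).
  by congr (_ +i* _) => /=; ring.
rewrite /cintegral0y.
under eq_Rintegral => t _ do rewrite expP /=.
under [X in _ +i* X]eq_Rintegral => t _ do rewrite expP /=.
rewrite !Rintegral_osc//.
by rewrite /a /b !hornerN !opprK -[RHS]/(V.[0%:C]) horner_complex.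
Qed.

End Laplace.

(** * Universality of the coefficients *)

Section Universal.
Variable R : realType.

(** Only k + 1 variables are available; the entries with i > k are set to 0, which by
    [eq_ratio_coef] changes nothing. *)
Definition ratio_coef_mpoly (k m : nat) : mpoly.mpoly k.+1 R[i] :=
  @ratio_coef (mpoly.mpoly k.+1 R[i])
    (fun m => mpoly.mpolyC k.+1 (m%:R^-1 : R[i]))
    (fun i => if (i < k.+1)%N then mpoly.mpolyX R[i] (mpoly.mnm1 (inord i))
              else 0)
    k m.

Lemma meval_ratio_coef_mpoly (k m : nat) (v : nat -> R[i]) :
  mpoly.meval (fun i : 'I_k.+1 => v i) (ratio_coef_mpoly k m)
  = ratio_coef (fun m => m%:R^-1) v k m.
Proof.
rewrite rmorph_ratio_coef; set w := _ \o _; set v' := _ \o _.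
have -> : w = (fun m => m%:R^-1).
  by apply/funext => n; rewrite /w /= mpoly.mevalC.
apply: eq_ratio_coef => i ik; rewrite /v' /= ltnS ik mpoly.mevalXU inordK//.
Qed.

(** The degree d enters only through d^(-k), which comes from x^k = (d n)^(-k). *)
Definition ratio_coef_Cdmu (k m : nat) : Cdmu R k.+1 :=
  ((FracField.tofrac 'X)^-1 ^+ k : Cd R) *:
    mpoly.map_mpoly (@FracField.tofrac {poly R[i]} \o @polyC R[i])
      (ratio_coef_mpoly k m).

Lemma Cdmu_value_ratio_coef (d : nat) (r : 'I_d -> R[i]) (k m : nat) :
  (0 < d)%N ->
  Cdmu_value (ratio_coef_Cdmu k m) r
    (d%:R^-1 ^+ k * ratio_coef (fun m => m%:R^-1) (fun i => mu r i.+1) k m).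
Proof.
move=> d0; exists ((d%:R^-1 ^+ k : R[i]) *: ratio_coef_mpoly k m); split.
  move=> e; exists ((mpoly.mcoeff e (ratio_coef_mpoly k m))%:P), 'X^k.
  have dk0 : ('X^k : {poly R[i]}).[d%:R] != 0.
    by rewrite hornerXn expf_neq0// pnatr_eq0 -lt0n.
  split=> //.
    by rewrite mpoly.mcoeffZ mpoly.mcoeff_map_mpoly rmorphXn exprVn mulrC.
  by rewrite mpoly.mcoeffZ hornerC hornerXn exprVn mulrC.
by rewrite mpoly.mevalZ (meval_ratio_coef_mpoly k m (fun i => mu r i.+1)).
Qed.

End Universal.

(** * The expansion *)

Section Expansion.
Variable R : realType.
Implicit Type z : R[i].

Lemma cvg_sumc (L : nat) (s : nat -> nat -> R[i]) (l : nat -> R[i]) :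
  (forall k, (s k : nat -> R[i]^o) @ \oo --> (l k : R[i]^o)) ->
  (fun n => \sum_(k < L) s k n : R[i]^o) @ \oo --> (\sum_(k < L) l k : R[i]^o).
Proof.
move=> sl; elim: L => [|L IH].
  under eq_fun do rewrite big_ord0; rewrite big_ord0; exact: cvg_cst.
have -> : (fun n => \sum_(k < L.+1) s k n : R[i]^o)
    = (fun n => \sum_(k < L) s k n - -1 * s L n : R[i]^o).
  by apply/funext => n; rewrite big_ord_recr mulN1r opprK.
have -> : \sum_(k < L.+1) l k = \sum_(k < L) l k - -1 * l L.
  by rewrite big_ord_recr mulN1r opprK.
exact: cvg_subc IH (cvg_mulc (c := -1) (sl L)).
Qed.

(** Listing the r_i with n-fold repetition makes the results on lists of size N = d n applicable to
    Q^n. *)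
Lemma prod_XD_expE (d n : nat) (r : 'I_d -> R[i]) :
  (\prod_(i < d) ('X + (r i)%:P)) ^+ n
  = \prod_(s <- flatten (nseq n (codom r))) ('X + s%:P).
Proof.
elim: n => [|n IH]; first by rewrite big_nil.
by rewrite exprS IH /= big_cat /= big_map big_enum.
Qed.

Lemma sum_flatten_nseq (d n : nat) (r : 'I_d -> R[i]) (f : R[i] -> R[i]) :
  \sum_(s <- flatten (nseq n (codom r))) f s = n%:R * \sum_(i < d) f (r i).
Proof.
elim: n => [|n IH]; first by rewrite big_nil mul0r.
by rewrite /= big_cat /= IH big_map big_enum /= -natr1 mulrDl mul1r addrC.
Qed.

Lemma size_flatten_codom (d n : nat) (r : 'I_d -> R[i]) :
  size (flatten (nseq n (codom r))) = (d * n)%N.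
Proof.
by elim: n => [|n IH]; rewrite ?muln0//= size_cat IH size_codom card_ord mulnS.
Qed.

Lemma Fn_sum (d n : nat) (r : 'I_d -> R[i]) z :
  let Q := \prod_(i < d) ('X + (r i)%:P) in
  let rs := flatten (nseq n (codom r)) in
  let N := (d * n)%N in
  0 < complex.Re z ->
  Fn Q n z
  = \sum_(m < N.+1) (\prod_(s <- rs) (1 + s *: 'X))`_m / (N ^_ m)%:R * z ^+ m.
Proof.
move=> Q rs N z0; have zn0 : z != 0 by apply: contraTneq z0 => ->; rewrite ltxx.
have Qn : Q ^+ n = \prod_(s <- rs) ('X + s%:P) by exact: prod_XD_expE.
have Nrs : size rs = N by exact: size_flatten_codom.
have sQ : size Q = d.+1.
  by rewrite -[Q]expr1 prod_XD_expE size_prod_XD size_flatten_codom muln1.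
rewrite /Fn sQ /= -/N.
rewrite (_ : (fun t : R => _) =
  (fun t : R => cexp (- z * t%:C) * (\prod_(s <- rs) ('X + s%:P)).[t%:C]));
  last first.
  by apply/funext => t; rewrite -Qn horner_exp.
(* The substitution j = N - m turns j! / z^(j + 1) into (N - m)! / z^(N - m + 1), and N! / (N - m)!
   is [N ^_ m]. *)
rewrite cintegral_horner// size_prod_XD Nrs (reindex_inj rev_ord_inj) mulr_sumr.
apply: eq_bigr => m _ /=; have mN : (m <= N)%N by rewrite -ltnS.
have PE : (\prod_(s <- rs) ('X + s%:P))`_(N - m)
    = (\prod_(s <- rs) (1 + s *: 'X))`_m.
  by have := @coef_prod_XD _ rs m; rewrite Nrs; apply.
rewrite subSS PE.
have -> : z ^+ N.+1 = z ^+ (N - m).+1 * z ^+ m.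
  by rewrite -exprD; congr (_ ^+ _); lia.
rewrite -(ffact_fact mN) natrM.
have f0 : (N - m)`!%:R != 0 :> R[i] by rewrite pnatr_eq0 -lt0n fact_gt0.
have g0 : (N ^_ m)%:R != 0 :> R[i] by rewrite pnatr_eq0 -lt0n ffact_gt0.
have h0 : z ^+ (N - m).+1 != 0 by rewrite expf_neq0.
move: (z ^+ (N - m).+1) h0 => w h0.
by field; rewrite f0 g0 h0.
Qed.


Lemma norm_mu_le (d : nat) (r : 'I_d -> R[i]) s : (0 < d)%N ->
  `|mu r s| <= (\sum_(i < d) `|r i|) ^+ s.
Proof.
move=> d0; set M := \sum_(i < d) _.
have rM i : `|r i| <= M by rewrite /M (bigD1 i)//= lerDl sumr_ge0.
rewrite /mu normrM normfV [`|d%:R|]ger0_norm ?ler0n// ler_pdivrMl ?ltr0n//.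
apply: le_trans (ler_norm_sum _ _ _) _.
apply: (@le_trans _ _ (\sum_(i < d) M ^+ s)).
  by apply: ler_sum => i _; rewrite normrX lerXn2r ?nnegrE ?(le_trans _ (rM i)).
by rewrite sumr_const card_ord mulr_natl.
Qed.

(** Gives the form K rho^m / m! that [majorant_cvg] and [entire_series] expect. *)
Lemma norm_ratio_coef_le M mu k m : (forall i, `|mu i| <= M ^+ i.+1) ->
  `|ratio_coef (fun m => m%:R^-1) mu k m|
    <= 4%:R * ((4 ^ k)%:R * M) ^+ m / m`!%:R :> R[i].
Proof.
move=> muM; apply: le_trans (norm_ratio_coef k m muM) _.
have M0 : 0 <= M by rewrite (le_trans _ (muM 0)) ?normr_ge0.
rewrite -!mulrA ler_wpM2l// exprMn -[leRHS]mulrA [leRHS]mulrCA.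
rewrite ler_wpM2l ?exprn_ge0// [leLHS]mulrC ler_wpM2r ?invr_ge0 ?ler0n//.
rewrite -!natrX ler_nat expnAC.
by case: k => // k; rewrite leq_exp2r ?sqr2_le_4expn.
Qed.

Lemma Fn_expansion (d : nat) (r : 'I_d -> R[i]) (A : nat -> R[i] -> R[i]) z l :
  let Q := \prod_(i < d) ('X + (r i)%:P) in
  let a k j :=
    d%:R^-1 ^+ k * ratio_coef (fun m => m%:R^-1) (fun i => mu r i.+1) k j in
  (0 < d)%N -> (forall k, has_coefs (A k) (a k)) -> 0 < complex.Re z ->
  exists2 B : R[i], 0 < B & forall n, (0 < n)%N ->
    `|Fn Q n z - \sum_(k < l) A k z * n%:R ^- k| <= B * n%:R ^- l.
Proof.
move=> Q a d0 Aa z0.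
pose M := \sum_(i < d) `|r i|; have M0 : 0 <= M by exact: sumr_ge0.
have rho0 : 0 <= (4 ^ l)%:R * M * `|z| by rewrite !mulr_ge0 ?ler0n.
have [B HB] := sum_expr_fact_bounded rho0.
have B0 : 0 <= B by have := HB 0%N; rewrite big_ord0.
exists ((4 * l.+1)%:R * B + 1) => [|n n0].
  by rewrite ltr_wpDl// mulr_ge0 ?ler0n.
pose N := (d * n)%N; have N0 : (0 < N)%N by rewrite muln_gt0 d0.
pose rs := flatten (nseq n (codom r)).
have Nrs : size rs = N by exact: size_flatten_codom.
have muE i : \sum_(s <- rs) s ^+ i.+1 = (size rs)%:R * mu r i.+1.
  rewrite Nrs sum_flatten_nseq natrM /mu mulrAC mulrA mulfV ?mul1r.
    by rewrite mulrC.
  by rewrite pnatr_eq0 -lt0n.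
have rsM : {in rs, forall s, `|s| <= M}.
  move=> s /flattenP[ss]; rewrite mem_nseq => /andP[_ /eqP ->] /codomP[i ->].
  by rewrite /M (bigD1 i)//= lerDl sumr_ge0.
have muM i : `|mu r i.+1| <= M ^+ i.+1 by exact: norm_mu_le.
have invnN : N%:R^-1 <= n%:R^-1 :> R[i].
  by rewrite lef_pV2 ?posrE ?ltr0n// ler_nat leq_pmull.
rewrite distrC.
pose s k J := n%:R ^- k * series (fun j => a k j * z ^+ j : R[i]^o) J.
have sA : (fun J => \sum_(k < l) s k J : R[i]^o) @ \oo
    --> (\sum_(k < l) A k z * n%:R ^- k : R[i]^o).
  have -> : \sum_(k < l) A k z * n%:R ^- k = \sum_(k < l) n%:R ^- k * A k z.
    by apply: eq_bigr => k _; rewrite mulrC.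
  apply: (@cvg_sumc l s (fun k => n%:R ^- k * A k z)) => k.
  exact: (cvg_mulc (c := n%:R ^- k) (Aa k z)).
apply: (cvg_norm_le sA); near=> J.
have NJ : (N < J)%N by near: J; exact: nbhs_infty_gt.
pose u m := (\prod_(s <- rs) (1 + s *: 'X))`_m / (N ^_ m)%:R.
(* The terms with m > N vanish because [N ^_ m] is 0 and so is its inverse. *)
have -> : Fn Q n z = \sum_(m < J) u m * z ^+ m.
  rewrite Fn_sum// -(subnKC NJ) big_split_ord /= [X in _ + X]big1 ?addr0//.
  move=> i _; rewrite /u ffact_small ?invr0 ?mulr0 ?mul0r//.
  by rewrite leq_addr.
(* The factors d^(-k) and n^(-k) combine into N^(-k). *)
have -> : \sum_(k < l) s k J = \sum_(m < J)
    (\sum_(k < l) ratio_coef (fun m => m%:R^-1) (fun i => mu r i.+1) k m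
       * N%:R^-1 ^+ k) * z ^+ m.
  under [RHS]eq_bigr do rewrite mulr_suml.
  rewrite exchange_big /=; apply: eq_bigr => k _.
  rewrite /s /series /= big_mkord mulr_sumr; apply: eq_bigr => j _.
  rewrite /a natrM invfM exprMn -!exprVn; ring.
rewrite -sumrB; apply: le_trans (ler_norm_sum _ _ _) _.
apply: (@le_trans _ _ ((4 * l.+1)%:R * B * n%:R ^- l)); last first.
  by rewrite ler_wpM2r ?invr_ge0 ?exprn_ge0 ?ler0n// lerDl.
apply: le_trans (_ : _ <= (4 * l.+1)%:R * (\sum_(j < J)
   ((4 ^ l)%:R * M * `|z|) ^+ j / j`!%:R) * n%:R ^- l) _; last first.
  by rewrite ler_wpM2r ?invr_ge0 ?exprn_ge0 ?ler0n// ler_wpM2l ?ler0n.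
rewrite mulr_sumr mulr_suml; apply: ler_sum => m _.
rewrite -mulrBl normrM normrX distrC /u -Nrs.
have Nrs0 : (0 < size rs)%N by rewrite Nrs.
have := coef_prod_expansion m l Nrs0 muE muM rsM.
move=> /(ler_wpM2r (exprn_ge0 m (normr_ge0 z))) /le_trans; apply.
have -> : (4 * l.+1)%:R * (((4 ^ l)%:R * M * `|z|) ^+ m / m`!%:R) * n%:R ^- l
  = (4 * l.+1)%:R * ((4 ^ l)%:R * M) ^+ m / m`!%:R * n%:R ^- l * `|z| ^+ m.
  by rewrite [(_ * `|z|) ^+ m]exprMn; ring.
rewrite ler_wpM2r ?exprn_ge0// ler_wpM2l//.
  by rewrite !mulr_ge0 ?invr_ge0 ?exprn_ge0 ?mulr_ge0 ?ler0n.
(* Since N = d n >= n, the power N^(-l) is at most n^(-l). *)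
by rewrite -exprVn lerXn2r ?nnegrE ?invr_ge0 ?ler0n// Nrs.
Unshelve. all: by end_near. Qed.

End Expansion.

Theorem theorem1p3 (R : realType) :
  exists P : forall k : nat, nat -> Cdmu R k.+1,
  forall (d : nat) (r : 'I_d -> R[i]), (0 < d)%N ->
  let Q : {poly R[i]} := \prod_(i < d) ('X + (r i)%:P) in
  exists (A : nat -> R[i] -> R[i]) (a : nat -> nat -> R[i]),
    [/\ forall k : nat, entire (A k),
        forall k : nat, has_coefs (A k) (a k),
        forall k j : nat, Cdmu_value (P k j) r (a k j)
      & forall z : R[i], 0 < complex.Re z ->
        forall l : nat,
          (fun n : nat =>
             Fn Q n z - \sum_(k < l.+1) A k z * n%:R ^- k : R[i]^o)
          =O_\oo (fun n : nat => n%:R ^- l.+1 : R[i]^o)].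
Proof.
exists (@ratio_coef_Cdmu R) => d r d0 Q.
pose a k j := d%:R^-1 ^+ k
  * ratio_coef (fun m => m%:R^-1) (fun i => mu r i.+1) k j : R[i].
pose M := \sum_(i < d) `|r i|; have M0 : 0 <= M by exact: sumr_ge0.
have rho0 k : 0 <= (4 ^ k)%:R * M by rewrite mulr_ge0 ?ler0n.
have ale k j : `|a k j| <= 4%:R * ((4 ^ k)%:R * M) ^+ j / j`!%:R.
  apply: le_trans (norm_ratio_coef_le k j (fun i => norm_mu_le r i.+1 d0)).
  rewrite normrM ler_piMl// normrX normfV ger0_norm ?ler0n//.
  by rewrite exprn_ile1 ?invr_ge0 ?ler0n// invf_le1 ?ltr0n// ler1n.
(* Each A_k is defined pointwise as the limit of its power series. *)
have ex k z : exists l : R[i],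
    series (fun j => a k j * z ^+ j : R[i]^o) @ \oo --> (l : R[i]^o).
  apply: (majorant_cvg (mulr_ge0 (rho0 k) (normr_ge0 z)) (K := 4%:R)) => j.
  rewrite normrM normrX [(_ * `|z|) ^+ j]exprMn mulrA [leRHS]mulrAC.
  by rewrite ler_wpM2r ?exprn_ge0.
have Aa k : has_coefs (fun z => sval (cid (ex k z))) (a k).
  by move=> z; case: cid.
exists (fun k z => sval (cid (ex k z))), a; split.
- by move=> k; exact: entire_series (rho0 k) (ale k) (Aa k).
- exact: Aa.
- by move=> k j; exact: Cdmu_value_ratio_coef.
move=> z z0 l; have [B B0 HB] := Fn_expansion l.+1 d0 Aa z0.
apply/eqO_exP; exists B => //; near=> n.
rewrite [`|n%:R ^- _|]ger0_norm ?invr_ge0 ?exprn_ge0 ?ler0n//.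
by apply: HB; near: n; exact: nbhs_infty_gt.
Unshelve. all: by end_near. Qed.
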